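(* Let $y:\Omega\to\mathbb{R}^n$ be bounded, and let $$L^{Tik}(u)=\mathbb{E}_{\rho_x}\big(|u(x)-y(x)|^2+|\nabla u(x)|^2\big),\ u\in U,\qquad L^{Tik}_N(\phi)=\frac1N\sum_{i=1}^N\big(|\phi(x_i)-y(x_i)|^2+|\nabla \phi(x_i)|^2\big),\ \phi\in V,$$ where $x_1,\dots,x_N$ are i.i.d. samples from $\rho_x$ and $V\subset U$. Let $\hat u\in U$ be the unique minimizer of $L^{Tik}$ over $U$, let $\hat\phi\in V$ be a $\delta$-minimizer of $L^{Tik}$ over $V$, and let $\hat\phi^N\in V$ be a $\delta$-minimizer of $L^{Tik}_N$ over $V$. Assume: (A1) (approximation error) there exists $\phi\in V$ with $\|\phi-\hat u\|_{H^1(\rho_x)}^2\le C_1^2\,\|\hat u\|_*^2/m^{\gamma}$; (A2) (quadrature error) for every $0<\epsilon<1$, with probability at least $1-\epsilon$ over the choice of $x_1,\dots,x_N$, $\ \sup_{\phi\in V}|L^{Tik}(\phi)-L^{Tik}_N(\phi)|\le C_2(V,m,\epsilon)/\sqrt N$. Then: (a) $$\|\hat\phi-\hat u\|_{H^1(\rho_x)}^2\le C_1^2\frac{\|\hat u\|_*^2}{m^\gamma}+\delta .$$ (b) For every $0<\epsilon<1$, with probability at least $1-\epsilon$ over the choice of $x_1,\dots,x_N$, $$\|\hat\phi^N-\hat u\|_{H^1(\rho_x)}^2\le C_1^2\frac{\|\hat u\|_*^2}{m^\gamma}+\frac{2C_2(V,m,\epsilon)}{\sqrt N}+2\delta .$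$
   Context: $\Omega\subset\mathbb{R}^d$ is a bounded domain, $\rho_x$ a probability distribution on $\Omega$. $U$ is a (linear) function space of functions $u:\Omega\to\mathbb{R}^n$ ($n\ge1$) for which the gradient is defined and $\mathbb{E}_{\rho_x}(|u|^2+|\nabla u|^2)<\infty$. $V\subset U$ is a set (of neural networks with finitely many parameters). $|\cdot|$ is the Euclidean norm (of vectors, and of the gradient/Jacobian viewed as a vector). The norm is $\|v\|_{H^1(\rho_x)}^2:=\mathbb{E}_{\rho_x}(|v|^2+|\nabla v|^2)$. $\|\cdot\|_*$ is the norm of some given space containing $\hat u$; $C_1\geq 0$ is a constant, $m>0$ is a constant (related to the number of parameters of the networks in $V$), $\gamma$ is a constant order, and $C_2(V,m,\epsilon)$ is a constant depending on $V,m,\epsilon$ (and possibly other factors such as $d$), but not on the sample. For a functional $L$ on a set $W$ and $\delta\ge0$, $\hat w\in W$ is a $\delta$-minimizer of $L$ over $W$ if $L(\hat w)\le\inf_{w\in W}L(w)+\delta$. *)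

(* Defs.v *)
From HB Require Import structures.
From mathcomp Require Import all_boot all_order all_algebra.
From mathcomp Require Import all_classical all_reals all_analysis.

Set Implicit Arguments.
Unset Strict Implicit.
Unset Printing Implicit Defensive.

Import Order.TTheory GRing.Theory Num.Theory.
Import numFieldNormedType.Exports.

Local Open Scope classical_set_scope.
Local Open Scope ring_scope.

(* R^d with its Borel sigma-algebra, generated by the topology of 'rV[R]_d. *)
Notation borel_rV R d := (g_sigma_algebraType (@open 'rV[R]_d)).

(* The norm `|A| of the library is the max norm; this is the Euclidean norm of
   A seen as a vector of entries. *)
Definition euclidean_norm (R : realType) (m n : nat) (A : 'M[R]_(m, n)) : R :=
  Num.sqrt (\sum_i \sum_j A i j ^+ 2).

Definition has_gradient (R : realType) (d n : nat) (u : 'rV[R]_d -> 'rV[R]_n)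
    (x : 'rV[R]_d) : Prop :=
  forall i : 'I_d, derivable u x (delta_mx 0 i).

(* Row i holds the partial derivative along the i-th coordinate, as in the
   Jacobian 'J u x, with which it agrees where u is differentiable. *)
Definition gradient (R : realType) (d n : nat) (u : 'rV[R]_d -> 'rV[R]_n)
    (x : 'rV[R]_d) : 'M[R]_(d, n) :=
  \matrix_(i, j) ('D_(delta_mx 0 i) u x) 0 j.

Definition measurable_entries (R : realType) (d m n : nat)
    (Omega : set 'rV[R]_d) (f : 'rV[R]_d -> 'M[R]_(m, n)) : Prop :=
  forall i j, measurable_fun (Omega : set (borel_rV R d)) (fun x => f x i j).

Section H1.
Variables (R : realType) (d n : nat).
Variables (Omega : set 'rV[R]_d) (rho : probability (borel_rV R d) R).
Local Notation fn := ('rV[R]_d -> 'rV[R]_n).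

Definition sq_H1_norm (v : fn) : \bar R :=
  (\int[rho]_(x in Omega)
     (euclidean_norm (v x) ^+ 2 + euclidean_norm (gradient v x) ^+ 2)%:E)%E.

(* Functions on Omega are represented by total functions; the values outside
   the open set Omega play no role. *)
Definition H1 : set fn := [set u |
  [/\ {ae rho, forall x, Omega x -> has_gradient u x},
      measurable_entries Omega u,
      measurable_entries Omega (gradient u) &
      (sq_H1_norm u < +oo)%E]].

Definition tik_integrand (y u : fn) (x : 'rV[R]_d) : R :=
  euclidean_norm (u x - y x) ^+ 2 + euclidean_norm (gradient u x) ^+ 2.

Definition tik_loss (y u : fn) : \bar R :=
  (\int[rho]_(x in Omega) (tik_integrand y u x)%:E)%E.

Definition empirical_tik_loss (y : fn) (N : nat) (x : 'I_N -> 'rV[R]_d)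
    (phi : fn) : R :=
  N%:R^-1 * \sum_(i < N) tik_integrand y phi (x i).

End H1.

Definition minimizer (R : realType) (F : Type) (L : F -> \bar R) (W : set F)
    (w : F) : Prop :=
  W w /\ forall v, W v -> (L w <= L v)%E.

Definition delta_minimizer (R : realType) (F : Type) (L : F -> \bar R)
    (W : set F) (delta : R) (w : F) : Prop :=
  W w /\ (L w <= ereal_inf (L @` W) + delta%:E)%E.

Section Sampling.
Context (R : realType) (dT : measure_display) (T : measurableType dT).
Variable P : probability T R.

(* E has inner probability at least p; when E is measurable this is
   p <= P E. *)
Definition with_probability_at_least (p : R) (E : set T) : Prop :=
  exists A, [/\ measurable A, A `<=` E & (p%:E <= P A)%E].

Definition mutually_independent (dE : measure_display) (E : measurableType dE)
    (N : nat) (X : 'I_N -> {mfun T >-> E}) : Prop :=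
  forall (J : {set 'I_N}) (B : 'I_N -> set E),
    (forall i, measurable (B i)) ->
    P (\bigcap_(i in [set` J]) (X i @^-1` B i)) =
    (\prod_(i in J) P (X i @^-1` B i))%E.

Definition iid_samples (dE : measure_display) (E : measurableType dE)
    (rho : probability E R) (N : nat) (X : 'I_N -> {mfun T >-> E}) : Prop :=
  mutually_independent X /\
  forall i B, measurable B -> distribution P (X i) B = rho B.

End Sampling.

(* Main.v *)
(* Along a segment of U the Tikhonov loss is a quadratic polynomial,
   L (u + t (v - u)) = (1 - t) L u + t L v - t (1 - t) |v - u|^2 (H^1 norm),
   so that its minimality at t = 0 for u = u_hat gives the Pythagorean identity
   L v = L u_hat + |v - u_hat|^2 on U: squared H^1 errors are excess losses.
   Thus a near-optimal loss on V has an error close to that of the approximant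
   of (A1), and passing from L to the empirical loss and back costs twice the
   quadrature error of (A2). The empirical minimizer is only controlled when all
   samples lie in Omega, which holds almost surely. *)
Require Import Defs.
From HB Require Import structures.
From mathcomp Require Import all_boot all_order all_algebra.
From mathcomp Require Import all_classical all_reals all_analysis.
From mathcomp Require Import measurable_realfun ring lra.
Import Order.TTheory GRing.Theory Num.Theory.
Import numFieldNormedType.Exports.
Local Open Scope classical_set_scope.
Local Open Scope ring_scope.

Set Implicit Arguments.
Unset Strict Implicit.

(** * Pointwise algebra of Euclidean norms, gradients and Tikhonov integrands *)

Lemma sqr_euclidean_norm (R : realType) (m n : nat) (A : 'M[R]_(m, n)) :
  euclidean_norm A ^+ 2 = \sum_i \sum_j A i j ^+ 2.
Proof.
rewrite sqr_sqrtr// sumr_ge0// => i _.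
by rewrite sumr_ge0// => j _; rewrite sqr_ge0.
Qed.

(** Holds entry by entry, as a polynomial identity in [t] and two scalars; this is the source of the
    quadratic behaviour of the loss along segments. *)
Lemma sqr_euclidean_norm_interp (R : realType) (m n : nat) (t : R)
    (A B : 'M[R]_(m, n)) :
  euclidean_norm (A + t *: (B - A)) ^+ 2 =
  (1 - t) * euclidean_norm A ^+ 2 + t * euclidean_norm B ^+ 2
    - t * (1 - t) * euclidean_norm (B - A) ^+ 2.
Proof.
rewrite !sqr_euclidean_norm !mulr_sumr -big_split -sumrB; apply: eq_bigr => i _.
rewrite !mulr_sumr -big_split -sumrB; apply: eq_bigr => j _.
by rewrite !mxE/=; ring.
Qed.

(** For entries [a], [b], the right side exceeds the left by [(a + b) ^+ 2]. *)
Lemma sqr_euclidean_normB_le (R : realType) (m n : nat) (A B : 'M[R]_(m, n)) :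
  euclidean_norm (A - B) ^+ 2
    <= 2 * euclidean_norm A ^+ 2 + 2 * euclidean_norm B ^+ 2.
Proof.
rewrite !sqr_euclidean_norm !mulr_sumr -big_split; apply: ler_sum => i _.
rewrite !mulr_sumr -big_split; apply: ler_sum => j _.
by rewrite !mxE/=; have := sqr_ge0 (A i j + B i j); nra.
Qed.

(** ['D_] has no meaningful value where the limit fails to exist, so linearity is claimed at points
    where both functions have partial derivatives. *)
Lemma gradientB (R : realType) (d n : nat) (u v : 'rV[R]_d -> 'rV[R]_n) x :
  has_gradient u x -> has_gradient v x ->
  gradient (u - v) x = gradient u x - gradient v x.
Proof. by move=> du dv; apply/matrixP => i j; rewrite !mxE deriveB// !mxE. Qed.

Lemma gradient_interp (R : realType) (d n : nat) (t : R)
    (u v : 'rV[R]_d -> 'rV[R]_n) x :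
  has_gradient u x -> has_gradient v x ->
  gradient (u + t *: (v - u)) x
    = gradient u x + t *: (gradient v x - gradient u x).
Proof.
move=> du dv; apply/matrixP => i j; rewrite !mxE.
have dB : derivable (v - u) x (delta_mx 0 i) by exact: derivableB.
have dZ : derivable (t *: (v - u)) x (delta_mx 0 i) := derivableZ dB.
have DZ : 'D_(delta_mx 0 i) (t *: (v - u)) x = t *: 'D_(delta_mx 0 i) (v - u) x
  := deriveZ t dB.
by rewrite (deriveD (du i) dZ) DZ (deriveB (dv i) (du i)) !mxE.
Qed.

Lemma tik_integrand_ge0 (R : realType) (d n : nat)
  (y u : 'rV[R]_d -> 'rV[R]_n) x : 0 <= tik_integrand y u x.
Proof. by rewrite addr_ge0// sqr_ge0. Qed.

(** The target [y] cancels in the difference of the residuals of [v] and [u], so the quadratic term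
    is the integrand with target [0]. *)
Lemma tik_integrand_interp (R : realType) (d n : nat) (t : R)
    (y u v : 'rV[R]_d -> 'rV[R]_n) x :
  has_gradient u x -> has_gradient v x ->
  tik_integrand y (u + t *: (v - u)) x =
  (1 - t) * tik_integrand y u x + t * tik_integrand y v x
    - t * (1 - t) * tik_integrand 0 (v - u) x.
Proof.
move=> du dv; rewrite /tik_integrand gradient_interp// gradientB//.
have -> : (u + t *: (v - u)) x - y x
    = (u x - y x) + t *: ((v x - y x) - (u x - y x)).
  by rewrite [in RHS]opprB [in RHS]addrA subrK addrAC.
have -> : (v - u) x - (0 : 'rV[R]_d -> 'rV[R]_n) x
    = (v x - y x) - (u x - y x).
  by rewrite subr0 opprB addrA subrK.
move: (u x - y x) (v x - y x) (gradient u x) (gradient v x) => A B F G.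
by rewrite !sqr_euclidean_norm_interp; ring.
Qed.

(** Lets the integrability results for the loss serve for the norm as well. *)
Lemma sq_H1_normE (R : realType) (d n : nat) (Omega : set 'rV[R]_d)
    (rho : probability (borel_rV R d) R) (v : 'rV[R]_d -> 'rV[R]_n) :
  sq_H1_norm Omega rho v = tik_loss Omega rho 0 v.
Proof. by apply: eq_integral => x _; rewrite /tik_integrand subr0. Qed.

(** * Measurability of the integrands *)

Lemma measurable_sqr_euclidean_norm (R : realType) (d m n : nat)
    (Omega : set 'rV[R]_d) (f : 'rV[R]_d -> 'M[R]_(m, n)) :
  measurable_entries Omega f ->
  measurable_fun (Omega : set (borel_rV R d))
    (fun x => euclidean_norm (f x) ^+ 2).
Proof.
move=> mf; under eq_fun do rewrite sqr_euclidean_norm.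
apply: measurable_sum => i; apply: measurable_sum => j.
by apply: measurable_funX; exact: mf.
Qed.

Lemma measurable_entries0 {R : realType} {d m n : nat} {Omega : set 'rV[R]_d} :
  measurable_entries Omega (0 : 'rV[R]_d -> 'M[R]_(m, n)).
Proof.
move=> i j; rewrite (_ : (fun _ => _) = cst 0); first exact: measurable_cst.
by apply/funext => x; rewrite !mxE.
Qed.

Lemma measurable_entriesB (R : realType) (d m n : nat)
    (Omega : set 'rV[R]_d) (f g : 'rV[R]_d -> 'M[R]_(m, n)) :
  measurable_entries Omega f -> measurable_entries Omega g ->
  measurable_entries Omega (f - g).
Proof.
move=> mf mg i j; rewrite (_ : (fun _ => _) = (fun x => f x i j - g x i j)).
  exact: measurable_funB (mf i j) (mg i j).
by apply/funext => x; rewrite !mxE.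
Qed.

(** * The Tikhonov loss as a quadratic functional *)

Section tikhonov.
Context {R : realType} {d n : nat}.
Context {Omega : set 'rV[R]_d} {rho : probability (borel_rV R d) R}.
Context (Omega_open : open Omega).
Local Notation fn := ('rV[R]_d -> 'rV[R]_n).

Lemma open_borel_measurable : measurable (Omega : set (borel_rV R d)).
Proof. exact: sub_sigma_algebra. Qed.
Let mOmega := open_borel_measurable.
Local Hint Resolve mOmega : core.

Lemma measurable_tik_integrand (y u : fn) :
  measurable_entries Omega y -> H1 Omega rho u ->
  measurable_fun (Omega : set (borel_rV R d)) (tik_integrand y u).
Proof.
move=> my [_ mu mdu _]; apply: measurable_funD.
  exact: measurable_sqr_euclidean_norm (measurable_entriesB mu my).
exact: measurable_sqr_euclidean_norm.
Qed.

(** Domination by [2 * tik_integrand 0 u + 2 * M ^+ 2]: the first term is integrable by membership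
    in [H1], the constant because [rho] is finite. *)
Lemma integrable_tik_integrand (y u : fn) :
  measurable_entries Omega y ->
  (exists M : R, forall x, Omega x -> euclidean_norm (y x) <= M) ->
  H1 Omega rho u ->
  rho.-integrable (Omega : set (borel_rV R d)) (EFin \o tik_integrand y u).
Proof.
move=> my [M yM] Hu; have i0 : rho.-integrable (Omega : set (borel_rV R d))
    (EFin \o tik_integrand 0 u).
  apply/integrableP; split.
    apply/measurable_EFinP.
    exact: measurable_tik_integrand measurable_entries0 _.
  under eq_integral => x _ do rewrite /= ger0_norm ?tik_integrand_ge0//.
  by case: Hu => _ _ _; rewrite sq_H1_normE.
have iy : rho.-integrable (Omega : set (borel_rV R d)) (EFin \o cst (M ^+ 2)).
  exact: finite_measure_integrable_cst.
have := integrableD mOmega (integrableZl mOmega 2 i0)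
  (integrableZl mOmega 2 iy).
apply: le_integrable => //.
  by apply/measurable_EFinP; exact: measurable_tik_integrand.
move=> x Ox; have y2 : euclidean_norm (y x) ^+ 2 <= M ^+ 2.
  (* The sign of [M] comes from the point [x] itself: [0 <= euclidean_norm (y x) <= M]. *)
  have nn := sqrtr_ge0 _ : 0 <= euclidean_norm (y x).
  by rewrite lerXn2r ?yM ?nnegrE// (le_trans nn)// yM.
rewrite /= lee_fin.
rewrite ger0_norm ?tik_integrand_ge0// ger0_norm; last first.
  by rewrite addr_ge0// mulr_ge0// ?tik_integrand_ge0// sqr_ge0.
have := sqr_euclidean_normB_le (u x) (y x).
rewrite /tik_integrand subr0.
by have := sqr_ge0 (euclidean_norm (gradient u x)); lra.
Qed.

Lemma tik_loss_interp (t : R) (y u v : fn) :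
  measurable_entries Omega y ->
  (exists M : R, forall x, Omega x -> euclidean_norm (y x) <= M) ->
  H1 Omega rho u -> H1 Omega rho v -> H1 Omega rho (v - u) ->
  H1 Omega rho (u + t *: (v - u)) ->
  tik_loss Omega rho y (u + t *: (v - u)) =
  ((1 - t)%:E * tik_loss Omega rho y u + t%:E * tik_loss Omega rho y v
    - (t * (1 - t))%:E * sq_H1_norm Omega rho (v - u)%R)%E.
Proof.
move=> my by_ Hu Hv Hvu Hw; rewrite sq_H1_normE.
(* The quadratic term has target [0], so its integrability needs a bound on the zero function. *)
have b0 : exists M : R, forall x, Omega x -> euclidean_norm ((0 : fn) x) <= M.
  exists 0 => x _; rewrite -sqrtr0 ler_wsqrtr// big1// => i _.
  by rewrite big1// => j _; rewrite mxE expr0n.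
have iu := integrable_tik_integrand my by_ Hu.
have iv := integrable_tik_integrand my by_ Hv.
have ivu := integrable_tik_integrand measurable_entries0 b0 Hvu.
have iZ k (f : borel_rV R d -> R) : rho.-integrable Omega (EFin \o f) ->
    rho.-integrable Omega (EFin \o (fun x => k * f x)).
  move=> fi; rewrite (_ : _ \o _ = fun x => (k%:E * (f x)%:E)%E)//.
  exact: integrableZl.
have iD : rho.-integrable Omega (EFin \o (fun x =>
    (1 - t) * tik_integrand y u x + t * tik_integrand y v x)).
  by have := integrableD mOmega (iZ (1 - t) _ iu) (iZ t _ iv).
transitivity (\int[rho]_(x in Omega) ((1 - t) * tik_integrand y u x
    + t * tik_integrand y v x - t * (1 - t) * tik_integrand 0 (v - u) x)%:E)%E.
  (* The gradients of [u] and [v] exist only almost everywhere in [Omega], and so does the pointwise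
     identity. *)
  apply: ae_eq_integral => //.
  - by apply/measurable_EFinP; exact: measurable_tik_integrand.
  - exact: measurable_int (integrableB mOmega iD (iZ (t * (1 - t)) _ ivu)).
  - case: Hu => du _ _ _; case: Hv => dv _ _ _.
    apply: (@filterS2 _ _ (ae_filter_ringOfSetsType rho)) du dv => x du dv Ox.
    by rewrite tik_integrand_interp ?du ?dv//; [exact: du | exact: dv].
transitivity (\int[rho]_(x in Omega) ((1 - t) * tik_integrand y u x
    + t * tik_integrand y v x)%:E
    - \int[rho]_(x in Omega) (t * (1 - t) * tik_integrand 0 (v - u) x)%:E)%E.
  by have := integralB mOmega iD (iZ (t * (1 - t)) _ ivu).
congr (_ - _)%E; last by have := integralZl mOmega ivu (t * (1 - t)).
transitivity (\int[rho]_(x in Omega) ((1 - t) * tik_integrand y u x)%:E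
    + \int[rho]_(x in Omega) (t * tik_integrand y v x)%:E)%E.
  by have := integralD mOmega (iZ (1 - t) _ iu) (iZ t _ iv).
congr (_ + _)%E.
  by have := integralZl mOmega iu (1 - t).
by have := integralZl mOmega iv t.
Qed.

(** Linearity of [U] keeps the whole line through [u] and [v] in [U]. Minimality may thus be tested
    at [t] of either sign, which forces the first-order term to vanish. *)
Lemma tik_loss_pythagoras (U : set fn) (y u v : fn) :
  GRing.submod_closed [in U] -> U `<=` H1 Omega rho ->
  measurable_entries Omega y ->
  (exists M : R, forall x, Omega x -> euclidean_norm (y x) <= M) ->
  minimizer (tik_loss Omega rho y) U u -> U v ->
  tik_loss Omega rho y v
    = (tik_loss Omega rho y u + sq_H1_norm Omega rho (v - u)%R)%E.
Proof.
move=> Ulin UH1 my by_ [Uu umin] Uv.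
have Uvu : U (v - u).
  have := Ulin.2 (-1) u v; rewrite !inE scaleN1r addrC; exact.
have Uw t : U (u + t *: (v - u)).
  have := Ulin.2 t (v - u) u; rewrite !inE [t *: _ + _]addrC; exact.
have fin w : U w -> tik_loss Omega rho y w \is a fin_num.
  move=> /UH1 Hw.
  exact: integrable_fin_num (integrable_tik_integrand my by_ Hw).
have fvu : sq_H1_norm Omega rho (v - u) \is a fin_num.
  rewrite ge0_fin_numE; first by case: (UH1 _ Uvu).
  by apply: integral_ge0 => x _; rewrite lee_fin addr_ge0// sqr_ge0.
have c0 : (0 <= sq_H1_norm Omega rho (v - u)%R)%E.
  by apply: integral_ge0 => x _; rewrite lee_fin addr_ge0// sqr_ge0.
have key t : (tik_loss Omega rho y u <= (1 - t)%:E * tik_loss Omega rho y u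
    + t%:E * tik_loss Omega rho y v
    - (t * (1 - t))%:E * sq_H1_norm Omega rho (v - u)%R)%E.
  have := umin _ (Uw t).
  by rewrite (tik_loss_interp my by_ (UH1 _ Uu) (UH1 _ Uv) (UH1 _ Uvu)
                (UH1 _ (Uw t))).
(* Both losses and the norm are finite, so the rest is an argument on reals [a], [b], [c]. *)
move: key c0; move: (fin _ Uu) (fin _ Uv) fvu.
move: (tik_loss Omega rho y u) (tik_loss Omega rho y v) (sq_H1_norm _ _ _).
move=> [a| |] [b| |] [c| |]// _ _ _ key; rewrite lee_fin => c0.
rewrite -EFinD; congr EFin; apply/eqP; rewrite -subr_eq0 opprD addrA.
set D := b - a - c.
(* [key] says [0 <= t * D + t ^ 2 * c] for all [t]; a minimizing [t] is
   proportional to [- D / c], and [c + 1] guards against [c = 0]. *)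
have := key (- D / (c + 1)).
rewrite lee_fin => h.
have {}h : 0 <= - (D / (c + 1)) ^+ 2.
  have c1 : c + 1 != 0 by lra.
  have -> : - (D / (c + 1)) ^+ 2
      = (- D / (c + 1)) * D + (- D / (c + 1)) ^+ 2 * c by field.
  by move: h; rewrite {}/D; lra.
have : (D / (c + 1)) ^+ 2 == 0 by rewrite eq_le sqr_ge0 andbT -oppr_ge0.
by rewrite sqrf_eq0 mulf_eq0 invr_eq0 => /orP[//|/eqP]; lra.
Qed.

(** By the Pythagorean identity both losses are the loss of [u] plus a squared error; that common
    term is finite and cancels. *)
Lemma sq_H1_norm_excess (U : set fn) (y u v w : fn) (e : R) :
  GRing.submod_closed [in U] -> U `<=` H1 Omega rho ->
  measurable_entries Omega y ->
  (exists M : R, forall x, Omega x -> euclidean_norm (y x) <= M) ->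
  minimizer (tik_loss Omega rho y) U u -> U v -> U w ->
  (tik_loss Omega rho y w <= tik_loss Omega rho y v + e%:E)%E ->
  (sq_H1_norm Omega rho (w - u)%R <= sq_H1_norm Omega rho (v - u)%R + e%:E)%E.
Proof.
move=> Ulin UH1 my by_ umin Uv Uw.
have fu : tik_loss Omega rho y u \is a fin_num.
  exact: integrable_fin_num (integrable_tik_integrand my by_ (UH1 _ umin.1)).
move: (tik_loss_pythagoras Ulin UH1 my by_ umin Uv)
  (tik_loss_pythagoras Ulin UH1 my by_ umin Uw) fu.
move: (tik_loss Omega rho y v) (tik_loss Omega rho y w)
  (tik_loss Omega rho y u).
by move=> Lv Lw Lu -> -> fu; rewrite -addeA leeD2lE.
Qed.

End tikhonov.

(** * Near-minimizers and almost sure events *)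

Lemma delta_minimizer_le (R : realType) (F : Type) (L : F -> \bar R) (W : set F)
    (delta : R) (w v : F) :
  delta_minimizer L W delta w -> W v -> (L w <= L v + delta%:E)%E.
Proof.
move=> [_ wmin] Wv; rewrite (le_trans wmin)// leeD2r//.
by apply: ereal_inf_lbound; exists v.
Qed.

(** Removing from [A] a measurable null set that contains the complement of [F] costs no probability
    and leaves a measurable subset of [G]. *)
Lemma with_probability_at_least_ae (R : realType) (dT : measure_display)
    (T : measurableType dT) (P : probability T R) (p : R) (E F G : set T) :
  with_probability_at_least P p E -> {ae P, forall w, F w} ->
  (forall w, E w -> F w -> G w) -> with_probability_at_least P p G.
Proof.
move=> [A [mA AE pA]] [B [mB PB FB]] EFG; exists (A `\` B); split.
- exact: measurableD.
- move=> w [Aw nBw]; apply: EFG; first exact: AE.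
  by apply: contrapT => nFw; apply: nBw; exact: FB.
- rewrite (le_trans pA)// (measureDI P mA mB) -[leRHS]adde0 leeD2l// -PB.
  exact: measureIr.
Qed.

(** Each [X i] has law [rho], hence leaves [B] with probability zero, and finitely many null events
    have a null union. *)
Lemma iid_samples_ae_in (R : realType) (dT : measure_display)
    (T : measurableType dT) (P : probability T R) (dE : measure_display)
    (E : measurableType dE) (rho : probability E R) (N : nat)
    (X : 'I_N -> {mfun T >-> E}) (B : set E) :
  iid_samples P rho X -> measurable B -> rho B = 1%E ->
  {ae P, forall w, forall i, B (X i w)}.
Proof.
move=> [_ XB] mB rhoB.
apply: (@filter_forall _ _ _ _ (ae_filter_ringOfSetsType P)) => i.
exists (X i @^-1` ~` B); split => //.
- by apply: measurable_funPTI; exact: measurableC.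
- rewrite -[LHS]/(distribution P (X i) (~` B)) XB; last exact: measurableC.
  by rewrite probability_setC// rhoB subee.
Qed.

Unset Implicit Arguments.
Set Strict Implicit.

Theorem theorem5 (R : realType) (d n N : nat)
  (d_gt0 : (0 < d)%N) (n_gt0 : (0 < n)%N) (N_gt0 : (0 < N)%N)
  (Omega : set 'rV[R]_d)
  (Omega_open : open Omega) (Omega_connected : connected Omega)
  (Omega_bounded : bounded_set Omega)
  (rho : probability (borel_rV R d) R) (rho_Omega : rho Omega = 1%E)
  (U V : set ('rV[R]_d -> 'rV[R]_n))
  (U_linear : GRing.submod_closed [in U])
  (U_H1 : U `<=` H1 Omega rho) (V_U : V `<=` U)
  (y : 'rV[R]_d -> 'rV[R]_n)
  (y_measurable : measurable_entries Omega y)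
  (y_bounded : exists M : R, forall x, Omega x -> euclidean_norm (y x) <= M)
  (u_hat phi_hat : 'rV[R]_d -> 'rV[R]_n)
  (u_hat_min : minimizer (tik_loss Omega rho y) U u_hat)
  (u_hat_unique : forall u, minimizer (tik_loss Omega rho y) U u ->
     {ae rho, forall x, Omega x -> u x = u_hat x})
  (delta : R) (delta_ge0 : 0 <= delta)
  (phi_hat_min : delta_minimizer (tik_loss Omega rho y) V delta phi_hat)
  (dT : measure_display) (T : measurableType dT) (P : probability T R)
  (X : 'I_N -> {mfun T >-> borel_rV R d}) (X_iid : iid_samples P rho X)
  (phi_hatN : T -> 'rV[R]_d -> 'rV[R]_n)
  (phi_hatN_min : forall w, (forall i, Omega (X i w)) ->
     delta_minimizer (fun phi => (empirical_tik_loss y (X ^~ w) phi)%:E)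
       V delta (phi_hatN w))
  (Wstar : normedModType R)
  (iota : {linear Wstar -> ('rV[R]_d -> 'rV[R]_n)})
  (iota_inj : forall w, (forall x, Omega x -> iota w x = 0) -> w = 0)
  (u_star : Wstar) (u_starE : forall x, Omega x -> iota u_star x = u_hat x)
  (C1 m gamma : R) (C1_ge0 : 0 <= C1) (m_gt0 : 0 < m)
  (C2 : set ('rV[R]_d -> 'rV[R]_n) -> R -> R -> R)
  (A1 : exists2 phi, V phi &
     (sq_H1_norm Omega rho (phi - u_hat)%R
        <= (C1 ^+ 2 * (`|u_star| ^+ 2 / m `^ gamma))%:E)%E)
  (A2 : forall eps : R, 0 < eps -> eps < 1 ->
     with_probability_at_least P (1 - eps) [set w |
       (ereal_sup [set `|tik_loss Omega rho y phi
                         - (empirical_tik_loss y (X ^~ w) phi)%:E| | phi in V]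
          <= (C2 V m eps / Num.sqrt N%:R)%:E)%E]) :
  (sq_H1_norm Omega rho (phi_hat - u_hat)%R
     <= (C1 ^+ 2 * (`|u_star| ^+ 2 / m `^ gamma) + delta)%:E)%E /\
  (forall eps : R, 0 < eps -> eps < 1 ->
     with_probability_at_least P (1 - eps) [set w |
       (sq_H1_norm Omega rho (phi_hatN w - u_hat)%R
          <= (C1 ^+ 2 * (`|u_star| ^+ 2 / m `^ gamma)
              + 2 * C2 V m eps / Num.sqrt N%:R + 2 * delta)%:E)%E]).
Proof.
have [phi Vphi phiC] := A1.
(* Both bounds compare with the approximant [phi] of (A1); what remains each time is a comparison of
   losses. *)
have excess := sq_H1_norm_excess Omega_open U_linear U_H1 y_measurable y_bounded
  u_hat_min (V_U _ Vphi).
split.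
  have [Vphi_hat _] := phi_hat_min.
  rewrite EFinD (le_trans _ (leeD2r _ phiC))//; apply: excess; first exact: V_U.
  exact: delta_minimizer_le Vphi.
move=> eps eps0 eps1; have mOmega := open_borel_measurable Omega_open.
have inOmega := iid_samples_ae_in X_iid mOmega rho_Omega.
apply: with_probability_at_least_ae (A2 eps eps0 eps1) inOmega _.
move=> w /= quad /phi_hatN_min wmin; have [VphiN _] := wmin.
have fin psi : V psi -> tik_loss Omega rho y psi \is a fin_num.
  move=> /V_U/U_H1 Hpsi; apply: integrable_fin_num => //.
  exact: integrable_tik_integrand.
(* The bound on the supremum is read at each [psi] in [V], as a real inequality since the loss is
   finite there. *)
have {}quad psi : V psi -> `|fine (tik_loss Omega rho y psi)
    - empirical_tik_loss y (X ^~ w) psi| <= C2 V m eps / Num.sqrt N%:R.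
  move=> Vpsi; rewrite -lee_fin (le_trans _ quad)//.
  by apply: ereal_sup_ubound; exists psi; rewrite // -{1}(fineK (fin _ Vpsi)).
rewrite -addrA EFinD (le_trans _ (leeD2r _ phiC))//.
apply: excess; first exact: V_U.
(* Here [l], [e] are the true and empirical losses of [phi], and [l'], [e'] those of [phi_hatN w].
   The chain [l' <= e' + k / s <= e + delta + k / s <= l + delta + 2 * k / s] is then relaxed by
   [0 <= delta]. *)
have excess_le (l l' e e' k s : R) : `|l - e| <= k / s -> `|l' - e'| <= k / s ->
    e' <= e + delta -> l' <= l + (2 * k / s + 2 * delta).
  by rewrite -mulrA !ler_norml => /andP[? ?] /andP[? ?] ?; lra.
have wphi := delta_minimizer_le wmin Vphi.
rewrite -(fineK (fin _ Vphi)) -(fineK (fin _ VphiN)) lee_fin.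
exact: excess_le (quad _ Vphi) (quad _ VphiN) wphi.
Qed.
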